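(* Every partial cosilting right $R$-module is pure-injective. In particular, every cosilting module is pure-injective.
   Context: All modules are right modules over a unital associative ring $R$. For $\zeta:Q_0\to Q_1$, $\mathcal{B}_\zeta=\{X \mid \operatorname{Hom}_R(X,\zeta) \text{ is an epimorphism}\}$. $\operatorname{Cogen}(T)$ is the class of modules embeddable in a direct product of copies of $T$. $T$ is partial cosilting if there is an exact sequence $0\to T\to Q_0\xrightarrow{\zeta}Q_1$ with $Q_0,Q_1$ injective such that $T\in\mathcal{B}_\zeta$ and $\mathcal{B}_\zeta$ is closed under direct products; $T$ is cosilting if there is such an exact sequence with $\operatorname{Cogen}(T)=\mathcal{B}_\zeta$. A module $U$ is pure-injective if $\operatorname{Hom}_R(-,U)$ preserves exactness of all pure-exact sequences (short exact sequences preserved by $\operatorname{Hom}_R(F,-)$ for all finitely presented $F$). *)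

(* Defs.v *)
(* Right R-modules over a unital associative ring R are
   modelled as left modules over the converse ring R^c, i.e. as
   [lmodType R^c]; R-linear maps are [{linear X -> Y}]. *)
From HB Require Import structures.
From mathcomp Require Import all_boot all_order all_algebra.
Set Implicit Arguments. Unset Strict Implicit. Unset Printing Implicit Defensive.
Import GRing.Theory.
Local Open Scope ring_scope.

Notation rmod R := (lmodType (R^c)%type).

Section Defs.
Variable R : pzRingType.

Definition injective_module (Q : rmod R) : Prop :=
  forall (A B : rmod R) (i : {linear A -> B}) (f : {linear A -> Q}),
    injective i -> exists g : {linear B -> Q}, forall a, g (i a) = f a.

Definition B_class (Q0 Q1 : rmod R) (zeta : {linear Q0 -> Q1}) (X : rmod R) : Prop :=
  forall g : {linear X -> Q1}, exists f : {linear X -> Q0}, forall x, zeta (f x) = g x.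

Definition is_product (I : Type) (X : I -> rmod R) (P : rmod R)
    (p : forall i, {linear P -> X i}) : Prop :=
  forall (Y : rmod R) (f : forall i, {linear Y -> X i}),
    exists h : {linear Y -> P},
      (forall i y, p i (h y) = f i y) /\
      (forall h' : {linear Y -> P}, (forall i y, p i (h' y) = f i y) ->
         forall y, h' y = h y).

Definition closed_under_products (C : rmod R -> Prop) : Prop :=
  forall (I : Type) (X : I -> rmod R) (P : rmod R) (p : forall i, {linear P -> X i}),
    @is_product I X P p -> (forall i, C (X i)) -> C P.

Definition Cogen (T : rmod R) (X : rmod R) : Prop :=
  exists (I : Type) (P : rmod R) (p : forall i : I, {linear P -> T}),
    @is_product I (fun _ => T) P p /\ exists e : {linear X -> P}, injective e.

Definition exact_0TQQ (T Q0 Q1 : rmod R) (iota : {linear T -> Q0})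
    (zeta : {linear Q0 -> Q1}) : Prop :=
  injective iota /\ forall y, zeta y = 0 <-> exists t, iota t = y.

Definition partial_cosilting (T : rmod R) : Prop :=
  exists (Q0 Q1 : rmod R) (iota : {linear T -> Q0}) (zeta : {linear Q0 -> Q1}),
    [/\ injective_module Q0, injective_module Q1, exact_0TQQ iota zeta,
        B_class zeta T & closed_under_products (B_class zeta)].

Definition cosilting (T : rmod R) : Prop :=
  exists (Q0 Q1 : rmod R) (iota : {linear T -> Q0}) (zeta : {linear Q0 -> Q1}),
    [/\ injective_module Q0, injective_module Q1, exact_0TQQ iota zeta &
        forall X : rmod R, Cogen T X <-> B_class zeta X].

(* F is finitely presented: R^m -> R^n -> F -> 0 exact (free right modules
   R^n realised as row vectors over R^c, scaling on the right) *)
Definition finitely_presented (F : rmod R) : Prop :=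
  exists (m n : nat) (k : {linear 'rV[R^c]_m -> 'rV[R^c]_n})
         (q : {linear 'rV[R^c]_n -> F}),
    (forall y, exists v, q v = y) /\ (forall v, q v = 0 <-> exists w, k w = v).

Definition short_exact (A B C : rmod R) (f : {linear A -> B}) (g : {linear B -> C}) :=
  [/\ injective f, (forall b, g b = 0 <-> exists a, f a = b) &
      forall c, exists b, g b = c].

Definition pure_exact (A B C : rmod R) (f : {linear A -> B}) (g : {linear B -> C}) :=
  short_exact f g /\
  forall F : rmod R, finitely_presented F ->
    [/\ (forall h : {linear F -> A}, (forall x, f (h x) = 0) -> forall x, h x = 0),
        (forall h : {linear F -> B}, (forall x, g (h x) = 0) <->
            exists h0 : {linear F -> A}, forall x, f (h0 x) = h x) &
        (forall k : {linear F -> C}, exists h : {linear F -> B}, forall x, g (h x) = k x)].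

Definition pure_injective (U : rmod R) : Prop :=
  forall (A B C : rmod R) (f : {linear A -> B}) (g : {linear B -> C}),
    pure_exact f g ->
    [/\ (forall k : {linear C -> U}, (forall b, k (g b) = 0) -> forall c, k c = 0),
        (forall h : {linear B -> U}, (forall a, h (f a) = 0) <->
            exists k : {linear C -> U}, forall b, k (g b) = h b) &
        (forall e : {linear A -> U}, exists h : {linear B -> U}, forall a, h (f a) = e a)].

End Defs.

(* Main.v *)
(* Let B be the class of X such that Hom(X, zeta) is onto; since Q1 is
   injective, B is closed under submodules, and by hypothesis under products.

   Key point: if K_i is a well-ordered increasing chain of submodules of M with
   M/K_i in B, then M/(union of the K_i) is in B.  Given theta : M -> Q1 killing
   the union, embed M along every branch b of a tree of height I, by
   phi_b m = (the class of m in M/K_i at the node b|i, 0 elsewhere), in the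
   product of the M/K_i over all nodes.  For every set Z of branches, some
   functional on this product is theta along the branches in Z and 0 along the
   others; it lifts to some f_Z with values in Q0.  On K_i, phi_b depends only
   on b|i, so the restrictions of f_Z to the phi_b(K_i) are coded by one
   relation per node, and the labels of the tree are chosen so that such codes are
   exactly the branches.  By Cantor, some Z and Z' have the same code b, with b
   in Z but not in Z'; then (f_Z - f_Z') o phi_b kills every K_i and lifts
   theta.

   Transfinite induction then gives, for M the families (x_s) in T indexed by
   the finite sequences s in a set E, that the quotient of M by the families that
   are eventually constant on some cone {s | G included in s} is in B.  Since T
   is the kernel of zeta, there is a linear "limit" M -> T, sending an
   eventually constant family to its value.  For a pure extension of C by A,
   take for E the triples (a, c, c'): purity solves finitely many of the
   equations of a splitting at a time, and the limit of these partial solutions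
   extends any given map A -> T to the middle term. *)
From HB Require Import structures.
From mathcomp Require Import all_boot all_order all_algebra.
From mathcomp Require Import generic_quotient ring_quotient boolp wochoice.
Require Import Defs.
Set Implicit Arguments.
Unset Strict Implicit.
Unset Printing Implicit Defensive.
Import GRing.Theory.
Local Open Scope ring_scope.
Local Open Scope quotient_scope.

(** * Submodules, quotients and products *)

Record is_submodule (S : pzRingType) (M : lmodType S) (K : M -> Prop) : Prop :=
  IsSubmodule {
    submodule0 : K 0;
    submoduleD : forall x y, K x -> K y -> K (x + y);
    submoduleZ : forall a x, K x -> K (a *: x) }.

Section Submodules.
Variables (S : pzRingType) (M : lmodType S) (K : M -> Prop).
Hypothesis subK : is_submodule K.

Definition submodule_pred of is_submodule K : {pred M} := fun x => `[< K x >].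

Lemma submodule_predP : subsemimod_closed (submodule_pred subK).
Proof.
split; first split.
- by apply/asboolP; apply: submodule0.
- by move=> x y /asboolP Kx /asboolP Ky; apply/asboolP; apply: submoduleD.
- by move=> a x /asboolP Kx; apply/asboolP; apply: submoduleZ.
Qed.

HB.instance Definition _ :=
  GRing.isSubmodClosed.Build S M (submodule_pred subK) submodule_predP.

Definition submodule_type := {x : M | submodule_pred subK x}.

HB.instance Definition _ := SubChoice.on submodule_type.
HB.instance Definition _ :=
  GRing.SubChoice_isSubLmodule.Build S M (submodule_pred subK) submodule_type
    submodule_predP.

Lemma val_submoduleP (x : submodule_type) : K (val x).
Proof. exact/asboolP/(valP x). Qed.

Definition submodule_incl : {linear submodule_type -> M} := val.

Definition quotient_type := @Quotient.quot M (submodule_pred subK).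
HB.instance Definition _ := ZmodQuotient.on quotient_type.

Definition quotient_pi (x : M) : quotient_type := \pi_(quotient_type) x.

Lemma quotient_pi_surj (u : quotient_type) : exists m, quotient_pi m = u.
Proof. by exists (repr u); rewrite /quotient_pi reprK. Qed.

Lemma quotient_piP x y : quotient_pi x = quotient_pi y <-> K (x - y).
Proof.
split=> [/eqP|Kxy].
  by rewrite -Quotient.idealrBE => /asboolP.
by apply/eqP; rewrite -Quotient.idealrBE; apply/asboolP.
Qed.

Lemma quotient_piD x y : quotient_pi (x + y) = quotient_pi x + quotient_pi y.
Proof. exact: pi_addr. Qed.

Definition quotient_scale a (u : quotient_type) : quotient_type :=
  quotient_pi (a *: repr u).

Lemma quotient_scaleE a x :
  quotient_scale a (quotient_pi x) = quotient_pi (a *: x).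
Proof.
apply/quotient_piP; rewrite -scalerBr; apply: submoduleZ => //.
by apply/quotient_piP; rewrite /quotient_pi reprK.
Qed.

Lemma quotient_scaleA a b u :
  quotient_scale a (quotient_scale b u) = quotient_scale (a * b) u.
Proof.
by case: (quotient_pi_surj u) => x <-; rewrite !quotient_scaleE scalerA.
Qed.

Lemma quotient_scale1 : left_id 1 quotient_scale.
Proof.
move=> u; case: (quotient_pi_surj u) => x <-.
by rewrite quotient_scaleE scale1r.
Qed.

Lemma quotient_scaleDr : right_distributive quotient_scale +%R.
Proof.
move=> a u v; case: (quotient_pi_surj u) => x <-.
case: (quotient_pi_surj v) => y <-.
by rewrite -quotient_piD !quotient_scaleE scalerDr quotient_piD.
Qed.

Lemma quotient_scaleDl u : {morph quotient_scale^~ u : a b / a + b}.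
Proof.
move=> a b; case: (quotient_pi_surj u) => x <-.
by rewrite !quotient_scaleE scalerDl quotient_piD.
Qed.

HB.instance Definition _ := GRing.Zmodule_isLmodule.Build S quotient_type
  quotient_scaleA quotient_scale1 quotient_scaleDr quotient_scaleDl.

Lemma quotient_pi_linear : linear quotient_pi.
Proof.
by move=> a x y; rewrite quotient_piD -quotient_scaleE.
Qed.

HB.instance Definition _ :=
  GRing.isLinear.Build S M quotient_type _ quotient_pi quotient_pi_linear.

Lemma quotient_pi_eq0 m : quotient_pi m = 0 <-> K m.
Proof.
have -> : (0 : quotient_type) = quotient_pi 0 by rewrite linear0.
by rewrite quotient_piP subr0.
Qed.

End Submodules.

Section DependentProduct.
Variables (S : pzRingType) (I : Type) (X : I -> lmodType S).

Definition dprod := forall i, X i.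

HB.instance Definition _ := gen_eqMixin dprod.
HB.instance Definition _ := gen_choiceMixin dprod.

Lemma dprod_ext (u v : dprod) : (forall i, u i = v i) -> u = v.
Proof. exact: functional_extensionality_dep. Qed.

Definition dprod_add (u v : dprod) : dprod := fun i => u i + v i.
Definition dprod_opp (u : dprod) : dprod := fun i => - u i.
Definition dprod_zero : dprod := fun i => 0.
Definition dprod_scale a (u : dprod) : dprod := fun i => a *: u i.

Lemma dprod_addA : associative dprod_add.
Proof. by move=> u v w; apply: dprod_ext => i; apply: addrA. Qed.
Lemma dprod_addC : commutative dprod_add.
Proof. by move=> u v; apply: dprod_ext => i; apply: addrC. Qed.
Lemma dprod_add0 : left_id dprod_zero dprod_add.
Proof. by move=> u; apply: dprod_ext => i; apply: add0r. Qed.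
Lemma dprod_addN : left_inverse dprod_zero dprod_opp dprod_add.
Proof. by move=> u; apply: dprod_ext => i; apply: addNr. Qed.

HB.instance Definition _ :=
  GRing.isZmodule.Build dprod dprod_addA dprod_addC dprod_add0 dprod_addN.

Lemma dprod_scaleA a b u :
  dprod_scale a (dprod_scale b u) = dprod_scale (a * b) u.
Proof. by apply: dprod_ext => i; apply: scalerA. Qed.
Lemma dprod_scale1 : left_id 1 dprod_scale.
Proof. by move=> u; apply: dprod_ext => i; apply: scale1r. Qed.
Lemma dprod_scaleDr : right_distributive dprod_scale +%R.
Proof. by move=> a u v; apply: dprod_ext => i; apply: scalerDr. Qed.
Lemma dprod_scaleDl u : {morph dprod_scale^~ u : a b / a + b}.
Proof. by move=> a b; apply: dprod_ext => i; apply: scalerDl. Qed.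

HB.instance Definition _ := GRing.Zmodule_isLmodule.Build S dprod
  dprod_scaleA dprod_scale1 dprod_scaleDr dprod_scaleDl.

Definition dprod_proj i (u : dprod) : X i := u i.

Lemma dprod_proj_linear i : linear (@dprod_proj i).
Proof. by []. Qed.

HB.instance Definition _ i :=
  GRing.isLinear.Build S dprod (X i) _ (@dprod_proj i) (@dprod_proj_linear i).

Variables (Y : lmodType S) (f : forall i, {linear Y -> X i}).

Definition dprod_pair (y : Y) : dprod := fun i => f i y.

Lemma dprod_pair_linear : linear dprod_pair.
Proof. by move=> a x y; apply: dprod_ext => i; rewrite /dprod_pair linearP. Qed.

HB.instance Definition _ :=
  GRing.isLinear.Build S Y dprod _ dprod_pair dprod_pair_linear.

End DependentProduct.
(** Linearity is an argument, so that any function proved linear carries the canonical structure. *)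
Definition linear_fun_of (S : pzRingType) (U V : lmodType S) (f : U -> V)
  of linear f := f.

HB.instance Definition _ (S : pzRingType) (U V : lmodType S) (f : U -> V)
    (lin_f : linear f) :=
  GRing.isLinear.Build S U V _ (linear_fun_of lin_f) lin_f.

Lemma linear_of_fun (S : pzRingType) (U V : lmodType S) (f : U -> V) :
  linear f -> exists g : {linear U -> V}, forall x, g x = f x.
Proof. by move=> lin_f; exists (linear_fun_of lin_f). Qed.

(** For a set-theoretic section [s] of [g], the composite [h \o s] is linear because [h u] depends
    only on [g u]. *)
Lemma linear_factor_surj (S : pzRingType) (U V W : lmodType S)
    (g : {linear U -> V}) (h : {linear U -> W}) :
  (forall v, exists u, g u = v) -> (forall u, g u = 0 -> h u = 0) ->
  exists k : {linear V -> W}, forall u, k (g u) = h u.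
Proof.
move=> /choice[s gs] kerg.
have hs u : h (s (g u)) = h u.
  by apply/eqP; rewrite -subr_eq0 -linearB kerg// linearB gs subrr.
have lin_hs : linear (h \o s).
  move=> a x y /=; rewrite -linearP -[LHS]hs -[RHS]hs.
  by rewrite [in RHS]linearP !gs.
by have [k kE] := linear_of_fun lin_hs; exists k => u; rewrite kE /= hs.
Qed.

Lemma dprod_is_product (R : pzRingType) (I : Type) (X : I -> rmod R) :
  is_product (P := dprod X) (fun i => @dprod_proj R^c I X i).
Proof.
move=> Y f; exists (@dprod_pair R^c I X Y f); split=> [//|h' h'E y].
by apply: dprod_ext => i; apply: h'E.
Qed.

(** A partial linear map is given by its graph, so it can be prescribed on sums of generators; by
    additivity, single-valuedness need only be checked at 0. *)
Lemma injective_graph_extension (R : pzRingType) (Q B : rmod R)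
    (G : B -> Q -> Prop) :
  injective_module Q ->
  G 0 0 ->
  (forall x y p q, G x p -> G y q -> G (x + y) (p + q)) ->
  (forall a x p, G x p -> G (a *: x) (a *: p)) ->
  (forall p, G 0 p -> p = 0) ->
  exists g : {linear B -> Q}, forall x p, G x p -> g x = p.
Proof.
move=> injQ G0 GD GZ Gfun.
have Guniq x p q : G x p -> G x q -> p = q.
  move=> Gp Gq; apply/eqP; rewrite -subr_eq0; apply/eqP/Gfun.
  by rewrite -(subrr x); apply: GD => //;
    have := GZ (-1) _ _ Gq; rewrite !scaleN1r.
pose D x := exists p, G x p.
have subD : is_submodule D.
  split; first by exists 0.
    by move=> x y [p Gp] [q Gq]; exists (p + q); apply: GD.
  by move=> a x [p Gp]; exists (a *: p); apply: GZ.
have [f fG] := choice (fun x : submodule_type subD => val_submoduleP x).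
have lin_f : linear f.
  move=> a x y; apply: (Guniq (val (a *: x + y))) => //.
  by rewrite linearP; exact: GD _ _ _ _ (GZ a _ _ (fG x)) (fG y).
have [fl flE] := linear_of_fun lin_f.
have [g gE] := injQ _ _ (submodule_incl subD) fl val_inj.
exists g => x p Gxp.
have Dx : submodule_pred subD x by apply/asboolP; exists p.
have /= := gE (Sub x Dx); rewrite flE => ->.
by apply: (Guniq x) => //; have := fG (Sub x Dx).
Qed.

(** * The class of modules along which zeta lifts *)

Section LiftingClass.
Variables (R : pzRingType) (Q0 Q1 : rmod R) (zeta : {linear Q0 -> Q1}).
Hypotheses (injQ1 : injective_module Q1).
Hypothesis B_products : closed_under_products (B_class zeta).

Lemma B_class_dprod (I : Type) (X : I -> rmod R) :
  (forall i, B_class zeta (X i)) -> B_class zeta (dprod X).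
Proof. exact/B_products/dprod_is_product. Qed.

(* [B_quotient K] says that [M / K] belongs to [B_class zeta]. *)
Definition B_quotient (M : rmod R) (K : M -> Prop) : Prop :=
  forall theta : {linear M -> Q1}, (forall m, K m -> theta m = 0) ->
  exists f : {linear M -> Q0},
    (forall m, K m -> f m = 0) /\ (forall m, zeta (f m) = theta m).

Lemma B_class_quotient_type (M : rmod R) (K : M -> Prop)
    (subK : is_submodule K) :
  B_quotient K -> B_class zeta (quotient_type subK).
Proof.
move=> BK g.
have [m Km|f [fK fE]] := BK (g \o quotient_pi subK).
  by rewrite /= (quotient_pi_eq0 subK m).2 // linear0.
have [u /(quotient_pi_eq0 subK)/fK //|k kE] :=
  linear_factor_surj (h := f) (@quotient_pi_surj _ _ _ subK).
by exists k => x; have [u <-] := quotient_pi_surj x; rewrite kE fE.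
Qed.

(** [h] embeds M/K in [N]: [theta] passes to the image of [h], extends to [N] by injectivity of
    [Q1], and lifts there. *)
Lemma B_quotient_ker (M N : rmod R) (h : {linear M -> N}) (K : M -> Prop) :
  B_class zeta N -> (forall m, K m <-> h m = 0) -> B_quotient K.
Proof.
move=> BN Kh theta thetaK.
pose G x q := exists2 m, x = h m & q = theta m.
have [||||g gE] := @injective_graph_extension R Q1 N G injQ1.
- by exists 0; rewrite linear0.
- by move=> x y p q [m -> ->] [m' -> ->]; exists (m + m'); rewrite linearD.
- by move=> a x p [m -> ->]; exists (a *: m); rewrite linearZ.
- by move=> p [m /esym/Kh/thetaK] -> ->.
have [f fE] := BN g; exists (f \o h); split=> m /=.
  by move=> /Kh ->; rewrite linear0.
by rewrite fE; apply: gE; exists m.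
Qed.

End LiftingClass.

(** * Quotients by unions of well-ordered chains *)

Section Tree.
Variables (I : Type) (lt : I -> I -> Prop) (H : Type).

(* Recursion on accessibility makes a label at [i] a function of the labels
   below [i], so that functions on nodes are branches: see [label_of_fun]. *)
Fixpoint label (i : I) (a : Acc lt i) {struct a} : Type :=
  (forall j (ji : lt j i), label (Acc_inv a ji)) -> H.

Definition node (i : I) (a : Acc lt i) :=
  forall j (ji : lt j i), label (Acc_inv a ji).

(** Matching on [a] exposes the constructor on which [label a] unfolds to [node a -> H]. *)
Definition label_of_fun (i : I) (a : Acc lt i) : (node a -> H) -> label a :=
  match a with Acc_intro _ => id end.

Definition fun_of_label (i : I) (a : Acc lt i) : label a -> node a -> H :=
  match a with Acc_intro _ => id end.

Lemma label_of_funK (i : I) (a : Acc lt i) :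
  cancel (@label_of_fun i a) (@fun_of_label i a).
Proof. by case: a. Qed.

Definition branch := forall (i : I) (a : Acc lt i), label a.

HB.instance Definition _ := gen_eqMixin branch.

Definition restrict (b : branch) (i : I) (a : Acc lt i) : node a :=
  fun j ji => b j (Acc_inv a ji).

Definition agree_below (b b' : branch) (i : I) :=
  forall j (a : Acc lt j), lt j i -> b j a = b' j a.

Lemma restrict_eqP (b b' : branch) (i : I) (a : Acc lt i) :
  restrict b a = restrict b' a <-> agree_below b b' i.
Proof.
split=> [eq_bb' j aj ji|eq_bb'].
  (* Branches also depend on accessibility proofs, which are identified here. *)
  rewrite (Prop_irrelevance aj (Acc_inv a ji)).
  exact: (congr1 (fun g : node a => g j ji) eq_bb').
apply: functional_extensionality_dep => j.
by apply: functional_extensionality_dep => ji; apply: eq_bb'.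
Qed.

Hypothesis lt_trans : forall i j k, lt i j -> lt j k -> lt i k.
Hypothesis lt_total : forall i j, [\/ i = j, lt i j | lt j i].
Hypothesis lt_unbounded : forall i, exists j, lt i j.

Lemma agree_belowW (b b' : branch) i j :
  lt i j -> agree_below b b' j -> agree_below b b' i.
Proof. by move=> ij bb' k a ki; apply: bb'; apply: lt_trans ij. Qed.

Lemma common_upper_bound i j : exists2 k, lt i k & lt j k.
Proof.
have [->|ij|ji] := lt_total i j.
- by have [k jk] := lt_unbounded j; exists k.
- by have [k jk] := lt_unbounded j; exists k => //; apply: lt_trans jk.
- by have [k ik] := lt_unbounded i; exists k => //; apply: lt_trans ik.
Qed.

(** Each other branch in [s] differs from [b] at some index. A common bound of these indices works;
    it must be strict, since [agree_below] looks only below it. *)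
Lemma branch_separation (i0 : I) (b : branch) (s : seq branch) :
  exists i, forall c, c \in s -> agree_below c b i -> c = b.
Proof.
elim: s => [|c s [i sepi]]; first by exists i0.
have [->|cb] := pselect (c = b).
  by exists i => d; rewrite inE => /predU1P[->|/sepi].
have [j [a cbj]] : exists j (a : Acc lt j), c j a <> b j a.
  apply: contrapT => noj; apply: cb.
  apply: functional_extensionality_dep => j.
  apply: functional_extensionality_dep => a.
  by apply: contrapT => cbj; apply: noj; exists j, a.
have [k ik jk] := common_upper_bound i j.
exists k => d; rewrite inE => /predU1P[->|/sepi sepd] db; last first.
  exact/sepd/(agree_belowW ik).
by case: cbj; apply: db.
Qed.

(** [Z] collects the codes of sets not containing their own code. If [c Z] were outside [Z], then
    [Z] itself would put it inside; membership of [c Z] then supplies [Z']. *)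
Lemma branch_diagonal (c : (branch -> bool) -> branch) :
  exists Z Z' : branch -> bool, [/\ Z (c Z), ~~ Z' (c Z) & c Z' = c Z].
Proof.
pose Z b := `[< exists2 Z' : branch -> bool, c Z' = b & ~~ Z' b >].
have /asboolP[Z' cZ' Z'F] : Z (c Z).
  by apply: contrapT => /negP nZ; case/negP: (nZ); apply/asboolP; exists Z.
by exists Z, Z'; split=> //; apply/asboolP; exists Z'.
Qed.

End Tree.

Lemma sum_by_key (T U : eqType) (V : nmodType) (key : U -> T)
    (Z : pred T) (F : U -> V) (s : seq U) :
  (forall b, \sum_(p <- s | key p == b) F p = 0) ->
  \sum_(p <- s | Z (key p)) F p = 0.
Proof.
move=> F0; pose r := undup [seq key p | p <- s].
transitivity (\sum_(b <- r | Z b) \sum_(p <- s | key p == b) F p); last first.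
  by rewrite big1.
rewrite (exchange_big_dep (fun p => Z (key p))) /=; last first.
  by move=> b p Zb /eqP ->.
rewrite big_seq_cond [RHS]big_seq_cond; apply: eq_bigr => p /andP[ps Zp].
rewrite (eq_bigl (fun b => b == key p)); last first.
  by move=> b; rewrite eq_sym; case: eqVneq => [->|]; rewrite ?Zp ?andbF.
rewrite -big_filter filter_pred1_uniq ?undup_uniq ?big_seq1 //.
by rewrite mem_undup map_f.
Qed.

(** * The tree embedding and the lifting over a union of a chain *)

Section Chain.
Variables (R : pzRingType) (Q0 Q1 : rmod R) (zeta : {linear Q0 -> Q1}).
Hypotheses (injQ1 : injective_module Q1).
Hypothesis B_products : closed_under_products (B_class zeta).

Variables (I : Type) (lt : I -> I -> Prop).
Hypothesis lt_wf : well_founded lt.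
Hypothesis lt_trans : forall i j k, lt i j -> lt j k -> lt i k.
Hypothesis lt_total : forall i j, [\/ i = j, lt i j | lt j i].

Variables (M : rmod R) (K : I -> M -> Prop).
Hypothesis subK : forall i, is_submodule (K i).
Hypothesis K_mono : forall i j m, lt i j -> K i m -> K j m.
Hypothesis BK : forall i, B_quotient zeta (K i).

Local Notation branch := (branch lt (M -> Q0 -> Prop)).

Definition tree_node := {i : I & node (M -> Q0 -> Prop) (lt_wf i)}.

Definition tree_module : rmod R :=
  dprod (fun n : tree_node => quotient_type (subK (projT1 n)) : rmod R).

Definition tree_coord (b : branch) (n : tree_node) :
    {linear M -> quotient_type (subK (projT1 n))} :=
  if `[< restrict b (lt_wf (projT1 n)) = projT2 n >]
  then (quotient_pi (subK (projT1 n)) : {linear _ -> _})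
  else (\0 : {linear _ -> _}).

Definition tree_embed (b : branch) : {linear M -> tree_module} :=
  dprod_pair (tree_coord b).

(** Coordinates at height [i] or above vanish on [K i]; those at a height [k] below [i] see only the
    branch below [k]. *)
Lemma tree_embed_eq (b b' : branch) i m :
  agree_below b b' i -> K i m -> tree_embed b m = tree_embed b' m.
Proof.
move=> bb' Kim; apply: dprod_ext => -[k g] /=.
rewrite /dprod_pair /tree_coord /=.
have K0 : lt i k \/ i = k -> quotient_pi (subK k) m = 0.
  by move=> ik; apply/quotient_pi_eq0; case: ik => [/K_mono|<-//]; apply.
have [ik|ik|ki] := lt_total i k.
- by do 2!case: asboolP => _ //=; rewrite K0 //; right.
- by do 2!case: asboolP => _ //=; rewrite K0 //; left.
- by rewrite ((restrict_eqP b b' (lt_wf k)).2 (agree_belowW lt_trans ki bb')).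
Qed.

(** At a height [i] separating [b] from the other branches of [s], the coordinate at the node of [b]
    retains exactly the terms on [b], modulo [K i]. *)
Lemma tree_embed_sum_eq0 (i0 : I) (s : seq (branch * M)) (b : branch) :
  (forall i, exists j, lt i j) ->
  \sum_(p <- s) tree_embed p.1 p.2 = 0 ->
  exists i, K i (\sum_(p <- s | p.1 == b) p.2).
Proof.
move=> lt_unb sum0.
have [i sepi] :=
  branch_separation lt_trans lt_total lt_unb i0 b [seq p.1 | p <- s].
exists i; apply/(quotient_pi_eq0 (subK i)).
pose n : tree_node := existT _ i (restrict b (lt_wf i)).
have := congr1 (@dprod_proj _ _ _ n) sum0; rewrite linear0 linear_sum => <-.
rewrite linear_sum [LHS]big_mkcond [LHS]big_seq [RHS]big_seq.
apply: eq_bigr => p ps; rewrite /= /dprod_proj /dprod_pair /tree_coord /=.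
have [->|pb] := eqVneq p.1 b; first by rewrite asboolT.
rewrite asboolF // => /restrict_eqP/sepi pbE; case/eqP: pb; apply: pbE.
exact: map_f.
Qed.

Lemma tree_functional (i0 : I) (theta : {linear M -> Q1}) (Z : pred branch) :
  (forall i, exists j, lt i j) ->
  (forall i m, K i m -> theta m = 0) ->
  exists Theta : {linear tree_module -> Q1}, forall b m,
    Theta (tree_embed b m) = if Z b then theta m else 0.
Proof.
move=> lt_unb thetaK.
pose G x q := exists s : seq (branch * M),
  x = \sum_(p <- s) tree_embed p.1 p.2 /\ q = \sum_(p <- s | Z p.1) theta p.2.
have [||||Theta ThetaE] :=
  @injective_graph_extension R Q1 tree_module G injQ1.
- by exists [::]; rewrite !big_nil.
- by move=> x y p q [s [-> ->]] [t [-> ->]]; exists (s ++ t); rewrite !big_cat.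
- move=> a x p [s [-> ->]]; exists [seq (u.1, a *: u.2) | u <- s].
  rewrite !big_map !scaler_sumr.
  by split; apply: eq_bigr => u _ /=; rewrite linearZ.
- move=> p [s [/esym sum0 ->]].
  (* Single-valuedness: in a vanishing sum, the part on each branch lies in some [K i], which
     [theta] kills. *)
  apply: (sum_by_key (key := fst)) => b.
  rewrite -linear_sum.
  have [i /thetaK //] := tree_embed_sum_eq0 i0 b lt_unb sum0.
exists Theta => b m; apply: ThetaE; exists [:: (b, m)].
by rewrite big_seq1 big_mkcond big_seq1.
Qed.

Lemma B_quotient_unbounded_chain (i0 : I) :
  (forall i, exists j, lt i j) -> B_quotient zeta (fun m => exists i, K i m).
Proof.
move=> lt_unb theta thetaK.
have {}thetaK i m : K i m -> theta m = 0 by move=> Kim; apply: thetaK; exists i.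
have B_tree : B_class zeta tree_module.
  by apply: B_class_dprod => // n; apply: B_class_quotient_type.
have /choice[f fE] : forall Z : pred branch,
    exists f : {linear tree_module -> Q0}, forall b m,
      zeta (f (tree_embed b m)) = if Z b then theta m else 0.
  move=> Z; have [Theta ThetaE] := tree_functional i0 Z lt_unb thetaK.
  by have [f fTheta] := B_tree Theta; exists f => b m; rewrite fTheta.
(* Relations in place of functions spare the choice of a branch through [g]. *)
pose code Z : branch := fun i a => label_of_fun (fun (g : node _ a) m q =>
  exists2 b : branch, restrict b a = g & q = f Z (tree_embed b m)).
have [Z [Z' [ZZ Z'Z cZZ']]] := branch_diagonal code.
set b := code Z in ZZ Z'Z cZZ'.
exists ((f Z \o tree_embed b) \- (f Z' \o tree_embed b)).
split=> [m [i Kim]|m] /=; last by rewrite linearB !fE ZZ (negPf Z'Z) subr0.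
(* Both codes are read at the node of [b] at height [i]. The relation of [Z] holds there with
   witness [b], so that of [Z'] has a witness [b'] agreeing with [b] below [i]. *)
have := congr1 (fun c : branch =>
  fun_of_label (c i (lt_wf i)) (restrict b (lt_wf i)) m (f Z (tree_embed b m)))
  cZZ'.
rewrite /b /code !label_of_funK -/b => codeE.
have [b' /restrict_eqP b'b ->] : exists2 b' : branch,
    restrict b' (lt_wf i) = restrict b (lt_wf i) &
    f Z (tree_embed b m) = f Z' (tree_embed b' m).
  by rewrite codeE; exists b.
by rewrite (tree_embed_eq b'b Kim) subrr.
Qed.

Lemma B_quotient_chain (i0 : I) : B_quotient zeta (fun m => exists i, K i m).
Proof.
(* If there is a last index [k], the union is just [K k]. *)
have [[k kmax]|nomax] := pselect (exists k, forall i, ~ lt k i); last first.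
  apply: B_quotient_unbounded_chain => // i; apply: contrapT => ni.
  by apply: nomax; exists i => j ij; apply: ni; exists j.
suff -> : (fun m => exists i, K i m) = K k by [].
apply/funext => m; apply/propext; split=> [[i Kim]|Kkm]; last by exists k.
have [<-//|/K_mono|/kmax//] := lt_total i k; exact.
Qed.

End Chain.

(** * Limits of eventually constant families *)

(** The given order is known only through unique minima of nonempty sets: minima of pairs yield
    antisymmetry and totality, minima of triples transitivity. *)
Lemma strict_well_order (E : eqType) : exists lt : E -> E -> Prop,
  [/\ well_founded lt, forall i j k, lt i j -> lt j k -> lt i k &
      forall i j, [\/ i = j, lt i j | lt j i]].
Proof.
have [le le_wo] := well_ordering_principle E.
have le_min (A : E -> Prop) x : A x ->
    exists z, A z /\ forall y, A y -> le z y.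
  move=> Ax; have [|z [[Az zmin] _]] := le_wo (fun y => `[< A y >]).
    by exists x; apply/asboolP.
  by exists z; split=> [|y Ay]; [apply/asboolP|apply: zmin; apply/asboolP].
have eqle i j : le i j -> le j i -> i = j.
  move=> ij ji; have [|z [_ zuniq]] := le_wo (pred2 i j).
    by exists i; rewrite inE eqxx.
  have le_refl x : le x x.
    have [//|y [yx ymin]] := le_min (eq^~ x) x.
    by rewrite -{1}yx; apply: ymin.
  have zP k : k = i \/ k = j -> z = k.
    move=> kij; apply: zuniq; split.
      by rewrite inE; case: kij => ->; rewrite eqxx ?orbT.
    by move=> l /pred2P[] ->; case: kij => ->.
  by rewrite -(zP i) ?(zP j); [|right|left].
exists (fun i j => le i j /\ i <> j); split.
- move=> i; apply: contrapT => /(le_min (fun i => ~ Acc _ i))[z [nz zmin]].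
  apply: nz; constructor => y [yz neq_yz]; apply: contrapT => /zmin zy.
  exact/neq_yz/eqle.
- move=> i j k [ij neq_ij] [jk neq_jk].
  have [|z [zE zmin]] := le_min (fun y => [\/ y = i, y = j | y = k]) i.
    by constructor 1.
  have zi : z = i.
    case: zE => [//|zj|zk].
      case: neq_ij; apply: eqle => //.
      by rewrite -zj; apply: zmin; constructor 1.
    by case: neq_jk; apply: eqle => //; rewrite -zk; apply: zmin; constructor 2.
  split; first by rewrite -zi; apply: zmin; constructor 3.
  by move=> ik; apply: neq_jk; apply: eqle => //; rewrite -ik.
- move=> i j; have [->|neq_ij] := pselect (i = j); first by constructor 1.
  have [|z [zE zmin]] := le_min (fun y => y = i \/ y = j) i; first by left.
  case: zE => zE.
    by constructor 2; split=> //; rewrite -zE; apply: zmin; right.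
  by constructor 3; split; [rewrite -zE; apply: zmin; left|move/esym].
Qed.

Section Cones.
Variables (R : pzRingType) (Q0 Q1 : rmod R) (zeta : {linear Q0 -> Q1}).
Hypotheses (injQ1 : injective_module Q1).
Hypothesis B_products : closed_under_products (B_class zeta).
Variables (T : rmod R) (E : eqType).
Hypothesis BT : B_class zeta T.

Definition family : rmod R := dprod (fun _ : seq E => T).

Definition constant_on_cone (G : seq E) (x : T) (m : family) :=
  forall s : seq E, {subset G <= s} -> m s = x.

Lemma constant_on_coneW G G' x m :
  {subset G <= G'} -> constant_on_cone G x m -> constant_on_cone G' x m.
Proof. by move=> GG' mx s G's; apply: mx => e /GG'/G's. Qed.

Lemma constant_on_coneD G x y m n :
  constant_on_cone G x m -> constant_on_cone G y n ->
  constant_on_cone G (x + y) (m + n).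
Proof. by move=> mx ny s Gs; rewrite -(mx s) // -(ny s). Qed.

Lemma constant_on_coneZ G a x m :
  constant_on_cone G x m -> constant_on_cone G (a *: x) (a *: m).
Proof. by move=> mx s Gs; rewrite -(mx s). Qed.

(** [A] restricts the generators of the cone; it is the parameter of the transfinite induction. *)
Definition eventually_constant (A : E -> Prop) (m : family) := exists x G,
  (forall e, e \in G -> A e) /\ constant_on_cone G x m.

Lemma eventually_constantW (A B : E -> Prop) m :
  (forall e, A e -> B e) -> eventually_constant A m -> eventually_constant B m.
Proof.
by move=> AB [x [G [GA mx]]]; exists x, G; split=> // e /GA/AB.
Qed.

Lemma eventually_constant_submodule A : is_submodule (eventually_constant A).
Proof.
split.
- by exists 0, [::].
- move=> m n [x [G [GA mx]]] [y [G' [GA' ny]]]; exists (x + y), (G ++ G').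
  split=> [e|]; first by rewrite mem_cat => /orP[/GA|/GA'].
  apply: constant_on_coneD.
    by apply: constant_on_coneW mx => e eG; rewrite mem_cat eG.
  by apply: constant_on_coneW ny => e eG; rewrite mem_cat eG orbT.
- move=> a m [x [G [GA mx]]]; exists (a *: x), G.
  by split=> //; apply: constant_on_coneZ.
Qed.

(** These families are the ones constant on the cone of [F], that is, the kernel of the differences
    [m s - m F] over the [s] containing [F]. *)
Lemma B_quotient_finite (F : seq E) :
  B_quotient zeta (eventually_constant (fun e => e \in F)).
Proof.
pose P s : {linear family -> T} := @dprod_proj R^c (seq E) (fun=> T) s.
pose h s : {linear family -> T} :=
  if all (mem s) F then (P s \- P F : {linear _ -> _})
  else (\0 : {linear _ -> _}).
apply: (@B_quotient_ker _ _ _ _ injQ1 _ family (dprod_pair h)).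
  exact: B_class_dprod.
have hE s m : h s m = if all (mem s) F then m s - m F else 0.
  by rewrite /h; case: (all _ _).
move=> m; split=> [[x [G [GF mx]]]|hm].
  apply: dprod_ext => s; rewrite /= /dprod_pair hE.
  have [/allP Fs|//] := boolP (all (mem s) F).
  by rewrite (mx F) // (mx s) ?subrr // => e /GF/Fs.
exists (m F), F; split=> // s Fs; apply/eqP.
have := congr1 (fun u : family => u s) hm; rewrite /= /dprod_pair hE.
by have -> : all (mem s) F by [apply/allP]; move/eqP; rewrite subr_eq0.
Qed.

(** The chain is indexed by [A]. Stage [i] allows the elements strictly below [i], plus [i] and [F];
    absorbing [i] is why the hypothesis ranges over all finite [F']. *)
Lemma B_quotient_initial_segment (lt : E -> E -> Prop) (A : E -> Prop)
    (F : seq E) :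
  well_founded lt -> (forall i j k, lt i j -> lt j k -> lt i k) ->
  (forall i j, [\/ i = j, lt i j | lt j i]) ->
  (forall i j, lt i j -> A j -> A i) ->
  (forall i, A i -> forall F' : seq E,
    B_quotient zeta (eventually_constant (fun e => lt e i \/ e \in F'))) ->
  B_quotient zeta (eventually_constant (fun e => A e \/ e \in F)).
Proof.
move=> wf_lt lt_trans lt_total A_down BA.
have [[i0 Ai0]|A0] := pselect (exists i, A i); last first.
  suff -> : (fun e => A e \/ e \in F) = (fun e => e \in F).
    exact: B_quotient_finite.
  apply/funext => e; apply/propext; split=> [[Ae|//]|]; last by right.
  by case: A0; exists e.
pose I := {i | A i}.
pose K (i : I) :=
  eventually_constant (fun e => lt e (sval i) \/ e \in sval i :: F).
suff -> : eventually_constant (fun e => A e \/ e \in F)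
    = (fun m => exists i, K i m).
  apply: (@B_quotient_chain _ _ _ _ injQ1 B_products I
    (fun i j => lt (sval i) (sval j)) _ _ _ family K _ _ _ (exist _ i0 Ai0)).
  - move=> i; have [e ie] : exists e, sval i = e by exists (sval i).
    elim/(well_founded_ind wf_lt): e i ie => e IHe i ie.
    by constructor => j ji; apply: (IHe (sval j)); rewrite -?ie.
  - by move=> i j k; apply: lt_trans.
  - move=> [i Ai] [j Aj]; have [ij|ij|ji] := lt_total i j.
    + by constructor 1; apply: eq_exist.
    + by constructor 2.
    + by constructor 3.
  - by move=> i; apply: eventually_constant_submodule.
  - move=> i j m ij; apply: eventually_constantW => e /=.
    rewrite inE => -[ei|/predU1P[->|eF]]; first by left; apply: lt_trans ij.
      by left.
    by right; rewrite inE eF orbT.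
  - by move=> [i Ai]; apply: BA.
apply/funext => m; apply/propext.
split=> [[x [G [GA mx]]]|[[i Ai]]]; last first.
  apply: eventually_constantW => e /=.
  rewrite inE => -[/A_down|/predU1P[->|eF]]; by [left; auto|left|right].
(* [i] is an upper bound in [A] of the elements of [G] outside [F], starting from the default
   [i0]. *)
have [i [Ai Gi]] : exists i, A i /\
    forall e, e \in G -> [\/ lt e i, e = i | e \in F].
  elim: {mx} G GA => [|g G IHG] GA; first by exists i0.
  have [|i [Ai Gi]] := IHG.
    by move=> e eG; apply: GA; rewrite inE eG orbT.
  have [|Ag|gF] := GA g; first by rewrite mem_head.
    have [ig|ig|gi] := lt_total i g.
    - exists i; split=> // e; rewrite inE => /predU1P[->|/Gi//].
      by constructor 2.
    - exists g; split=> // e; rewrite inE => /predU1P[->|/Gi[ei|->|eF]].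
      + by constructor 2.
      + by constructor 1; apply: lt_trans ig.
      + by constructor 1.
      + by constructor 3.
    - exists i; split=> // e; rewrite inE => /predU1P[->|/Gi//].
      by constructor 1.
  exists i; split=> // e; rewrite inE => /predU1P[->|/Gi//].
  by constructor 3.
exists (exist _ i Ai), x, G; split=> // e /Gi[ei|->|eF] /=; first by left.
  by right; rewrite mem_head.
by right; rewrite inE eF orbT.
Qed.

Lemma B_quotient_cones : B_quotient zeta (eventually_constant (fun=> True)).
Proof.
have [lt [wf_lt lt_trans lt_total]] := strict_well_order E.
have -> : (fun _ : E => True) = (fun e => True \/ e \in [::]).
  by apply/funext => e; apply/propext; split=> // _; left.
apply: (B_quotient_initial_segment (A := fun=> True)) => // i _.
elim/(well_founded_ind wf_lt): i => i IHi F.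
apply: (B_quotient_initial_segment (A := lt^~ i)) => // j k jk.
exact: lt_trans.
Qed.

(** The eventual value, sent into [Q0] by [iota], extends to a map [p] on all families. Then
    [zeta \o p] kills the eventually constant families, so it lifts to some [f] killing them too,
    and [p - f] lands in the kernel of [zeta], which is [T]. *)
Lemma cone_limit (iota : {linear T -> Q0}) :
  injective_module Q0 -> exact_0TQQ iota zeta ->
  exists lim : {linear family -> T},
    forall G x m, constant_on_cone G x m -> lim m = x.
Proof.
move=> injQ0 [inj_iota ker_zeta].
pose C m q := exists x G, constant_on_cone G x m /\ q = iota x.
have [||||p pE] := @injective_graph_extension R Q0 family C injQ0.
- by exists 0, [::]; rewrite linear0.
- move=> m n _ _ [x [G [mx ->]]] [y [G' [ny ->]]].
  exists (x + y), (G ++ G'); rewrite linearD; split=> //.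
  apply: constant_on_coneD.
    by apply: constant_on_coneW mx => e eG; rewrite mem_cat eG.
  by apply: constant_on_coneW ny => e eG; rewrite mem_cat eG orbT.
- move=> a m _ [x [G [mx ->]]]; exists (a *: x), G; rewrite linearZ.
  by split=> //; apply: constant_on_coneZ.
- by move=> _ [x [G [mx ->]]]; rewrite -(mx G) // linear0.
have [m [x [G [_ mx]]]|f [fC fE]] := @B_quotient_cones (zeta \o p).
  by rewrite /= (pE m (iota x)); [apply/ker_zeta; exists x|exists x, G].
have /choice[lim limE] m : exists t, iota t = p m - f m.
  by apply/ker_zeta; rewrite linearB fE subrr.
have lin_lim : linear lim.
  move=> a m n; apply: inj_iota; rewrite limE [p _]linearP [f _]linearP.
  by rewrite [RHS]linearP !limE scalerBr opprD addrACA.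
have [lim' lim'E] := linear_of_fun lin_lim.
exists lim' => G x m mx; apply: inj_iota.
rewrite lim'E limE (pE m (iota x)); last by exists x, G.
by rewrite fC ?subr0 //; exists x, G.
Qed.

End Cones.

(** * Pure extensions *)

Section Purity.
Variables (R : pzRingType) (A B C : rmod R).
Variables (f : {linear A -> B}) (g : {linear B -> C}).
Hypothesis pure_fg : pure_exact f g.

(** A triple (a, c, c') encodes one linearity equation; [s] is linear when all defects vanish. *)
Definition section_defect (s : C -> B) (e : R^c * C * C) : B :=
  e.1.1 *: s e.1.2 + s e.2 - s (e.1.1 *: e.1.2 + e.2).

(** The elements of [C] occurring in [es] generate, subject to the relations [es], a finitely
    presented module [F] mapping to [C]. Purity lifts this map to [B], and [v] is the lift on
    generators. *)
Lemma pure_finite_lift (es : seq (R^c * C * C)) :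
  exists v : C -> B, forall e, e \in es ->
    [/\ g (v e.1.2) = e.1.2, g (v e.2) = e.2,
        g (v (e.1.1 *: e.1.2 + e.2)) = e.1.1 *: e.1.2 + e.2 &
        section_defect v e = 0].
Proof.
have [_ pure_lift] := pure_fg.
pose cs := flatten [seq [:: e.1.2; e.2; e.1.1 *: e.1.2 + e.2] | e <- es].
(* The basis vector at the first occurrence of [c], or zero if [c] is not in [cs]. *)
pose gen (c : C) : 'rV[R^c]_(size cs) := \row_j (j == index c cs :> nat)%:R.
pose rel (e : R^c * C * C) : 'rV[R^c]_(size cs) :=
  e.1.1 *: gen e.1.2 + gen e.2 - gen (e.1.1 *: e.1.2 + e.2).
pose rels : 'M[R^c]_(size es, size cs) :=
  \matrix_(i < size es) rel (tnth (in_tuple es) i).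
have [k kE] : exists k : {linear 'rV[R^c]_(size es) -> 'rV[R^c]_(size cs)},
    forall w, k w = w *m rels.
  by apply: linear_of_fun => a x y; rewrite mulmxDl scalemxAl.
have [ev evE] : exists ev : {linear 'rV[R^c]_(size cs) -> C},
    forall v, ev v = \sum_j v 0 j *: cs`_j.
  apply: linear_of_fun => a x y; rewrite scaler_sumr -big_split.
  by apply: eq_bigr => j _; rewrite !mxE scalerDl scalerA.
have ev_gen c : c \in cs -> ev (gen c) = c.
  move=> c_cs; have ics : (index c cs < size cs)%N by rewrite index_mem.
  rewrite evE (bigD1 (Ordinal ics)) //= mxE eqxx scale1r nth_index // big1.
    by rewrite addr0.
  move=> j /negPf jc; rewrite mxE -(inj_eq val_inj) /= in jc *.
  by rewrite jc scale0r.
have cs_es e : e \in es ->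
    [/\ e.1.2 \in cs, e.2 \in cs & e.1.1 *: e.1.2 + e.2 \in cs].
  move=> ees.
  have sub_cs : {subset [:: e.1.2; e.2; e.1.1 *: e.1.2 + e.2] <= cs}.
    move=> c cE; apply/flattenP; eexists; last exact: cE.
    exact: (map_f _ ees).
  by split; apply: sub_cs; rewrite !inE eqxx ?orbT.
have ev_rel e : e \in es -> ev (rel e) = 0.
  case/cs_es => c1 c2 c3.
  by rewrite /rel linearB linearD linearZ /= !ev_gen // subrr.
have sub_im : is_submodule (fun v => exists w, k w = v).
  split; first by exists 0; rewrite linear0.
    by move=> _ _ [w <-] [w' <-]; exists (w + w'); rewrite linearD.
  by move=> a _ [w <-]; exists (a *: w); rewrite linearZ.
pose F : rmod R := quotient_type sub_im.
pose q : {linear 'rV[R^c]_(size cs) -> F} := quotient_pi sub_im.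
have fpF : finitely_presented F.
  exists (size es), (size cs), k, q.
  by split; [apply: quotient_pi_surj|move=> v; apply: quotient_pi_eq0].
have q_rel e : e \in es -> q (rel e) = 0.
  move=> ees; apply/quotient_pi_eq0.
  have ies : (index e es < size es)%N by rewrite index_mem.
  exists (delta_mx 0 (Ordinal ies)); rewrite kE -rowE rowK (tnth_nth e) /=.
  by rewrite nth_index.
have [v|ev' ev'E] :=
    linear_factor_surj (g := q) (h := ev) (@quotient_pi_surj _ _ _ _).
  move/quotient_pi_eq0 => [w <-].
  rewrite kE mulmx_sum_row linear_sum big1 // => i _.
  by rewrite linearZ /= rowK ev_rel ?scaler0 // mem_tnth.
have [_ _ /(_ ev')[h hE]] := pure_lift F fpF.
have gv c : c \in cs -> g (h (q (gen c))) = c.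
  by move=> /ev_gen cE; rewrite hE ev'E.
exists (fun c => h (q (gen c))) => e ees; have [c1 c2 c3] := cs_es e ees.
split; rewrite ?gv // /section_defect.
by rewrite -linearZ /= -linearZ /= -!linearD -!linearB q_rel // linear0.
Qed.

(** Where [v] is a partial section, [s - v] takes values in the image of [f]; as [v] has no defect
    on [es], this difference has the defect of [s]. *)
Lemma pure_finite_solution (s : C -> B) (es : seq (R^c * C * C)) :
  (forall c, g (s c) = c) ->
  exists u : C -> A, forall e, e \in es ->
    f (e.1.1 *: u e.1.2 + u e.2 - u (e.1.1 *: e.1.2 + e.2))
    = section_defect s e.
Proof.
have [[_ ker_g _] _] := pure_fg.
move=> gs; have [v vE] := pure_finite_lift es.
have /choice[u uE] c : exists a, g (v c) = c -> f a = s c - v c.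
  have [gvc|ngvc] := pselect (g (v c) = c); last by exists 0.
  have [|a fa] := (ker_g (s c - v c)).1; last by exists a.
  by rewrite linearB gs gvc subrr.
exists u => e /vE[v1 v2 v3 v0].
rewrite linearB linearD linearZ /= !uE // -[RHS]subr0 -v0 /section_defect.
rewrite scalerBr addrACA -opprD !opprB addrACA [RHS]addrACA.
by congr (_ + _); apply: addrC.
Qed.
End Purity.

(** * Extension of maps along a pure embedding *)

Lemma pure_injective_of_partial_cosilting (R : pzRingType) (T : rmod R) :
  partial_cosilting T -> pure_injective T.
Proof.
move=> [Q0 [Q1 [iota [zeta [injQ0 injQ1 exact_iota BT B_products]]]]].
move=> A B C f g pure_fg; have [[inj_f ker_g /choice[s gs]] _] := pure_fg.
split.
- by move=> k kg c; rewrite -(gs c) kg.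
- move=> h; split=> [hf|[k kE] a]; last first.
    by rewrite -kE (ker_g (f a)).2 ?linear0 //; exists a.
  by apply: linear_factor_surj => [c|b /ker_g[a <-]//]; exists (s c).
move=> e; pose E := ((R^c) * C * C)%type.
have [lim limE] :=
  @cone_limit R Q0 Q1 zeta injQ1 B_products T E BT iota injQ0 exact_iota.
have /choice[u uE] es := pure_finite_solution pure_fg es gs.
pose tau c : family T E := fun es => e (u es c).
have /choice[alpha alphaE] (x : E) : exists a, f a = section_defect s x.
  by apply/ker_g; rewrite linearB linearD linearZ /= !gs subrr.
(* On the cone of the single triple (a, c, c'), the partial solutions all satisfy its equation, so
   the defect of [tau] is constant there. *)
have tauE a c c' : lim (tau (a *: c + c')) =
    a *: lim (tau c) + lim (tau c') - e (alpha (a, c, c')).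
  have <- : lim (a *: tau c + tau c' - tau (a *: c + c'))
      = e (alpha (a, c, c')).
    apply: (limE [:: (a, c, c')]) => es ces.
    have /uE /= : (a, c, c') \in es by apply: ces; rewrite mem_head.
    rewrite -(alphaE (a, c, c')) => /inj_f <-.
    by rewrite linearB linearD linearZ.
  by rewrite linearB opprB linearD linearZ /= addrCA subrr addr0.
(* [r b] is the [A]-component in the set-theoretic splitting b = f (r b) + s (g b). *)
have /choice[r rE] b : exists a, f a = b - s (g b).
  by apply/ker_g; rewrite linearB gs subrr.
have [h hE] : exists h : {linear B -> T},
    forall b, h b = e (r b) + lim (tau (g b)).
  (* The failures of linearity of [e \o r] and of [lim \o tau \o g] cancel. *)
  apply: linear_of_fun => a x y; rewrite linearP tauE.
  have -> : r (a *: x + y) = a *: r x + r y + alpha (a, g x, g y).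
    apply: inj_f; rewrite !linearD linearZ /= !rE alphaE /section_defect /=.
    by rewrite scalerBr linearP [_ + (y - _)]addrACA -opprD addrA subrK.
  rewrite [e (_ + alpha _)]linearD addrACA subrr addr0 linearP addrACA.
  by rewrite -scalerDr.
exists h => a; rewrite hE (ker_g (f a)).2; last by exists a.
(* [s 0] may be nonzero: [r (f a)] differs from [a] by the preimage [alpha (1, 0, 0)] of [s 0], and
   this term compensates. *)
have lim_tau0 : lim (tau 0) = e (alpha (1, 0, 0)).
  have := tauE 1 0 0; rewrite scale1r addr0 scale1r => /eqP.
  by rewrite eq_sym subr_eq => /eqP/addrI.
rewrite lim_tau0 -linearD; congr (e _); apply: inj_f.
rewrite linearD rE alphaE /section_defect /= (ker_g (f a)).2; last by exists a.
by rewrite scaler0 addr0 scale1r addrK subrK.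
Qed.

(** * Cosilting modules *)

Lemma dprod_pair_inj (S : pzRingType) (I : Type) (X : I -> lmodType S)
    (Y : lmodType S) (f : forall i, {linear Y -> X i}) :
  (forall y, (forall i, f i y = 0) -> y = 0) -> injective (dprod_pair f).
Proof.
move=> f_sep x y xy; apply/eqP; rewrite -subr_eq0; apply/eqP/f_sep => i.
have fxy : f i x = f i y := congr1 (fun u : dprod X => u i) xy.
by rewrite linearB fxy subrr.
Qed.

(** On the submodule killed by all projections, the inclusion and the zero map have the same
    components, so they agree by uniqueness. *)
Lemma is_product_separated (R : pzRingType) (I : Type) (X : I -> rmod R)
    (P : rmod R) (p : forall i, {linear P -> X i}) (x : P) :
  is_product p -> (forall i, p i x = 0) -> x = 0.
Proof.
move=> prodP px.
have subK : is_submodule (fun y => forall i, p i y = 0).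
  split=> [i|y z y0 z0 i|a y y0 i]; first by rewrite linear0.
    by rewrite linearD y0 z0 addr0.
  by rewrite linearZ /= y0 scaler0.
have [h [_ huniq]] :=
  prodP (submodule_type subK) (fun i => \0 : {linear _ -> _}).
have x_in : submodule_pred subK x by apply/asboolP.
pose y : submodule_type subK := Sub x x_in.
have yh : submodule_incl subK y = h y.
  by apply: huniq => i z; apply: (val_submoduleP z).
have y0 : (\0 : {linear submodule_type subK -> P}) y = h y.
  by apply: huniq => i z; apply: linear0.
by rewrite -[x]/(submodule_incl subK y) yh -y0.
Qed.

(** For the converse, [X] embeds in the power of [T] indexed by all linear maps from [X] to [T]. *)
Lemma Cogen_separated (R : pzRingType) (T X : rmod R) :
  Cogen T X <->
  (forall x : X, (forall k : {linear X -> T}, k x = 0) -> x = 0).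
Proof.
split=> [[I [P [p [prodP [e inj_e]]]]] x x0|sepX].
  apply: inj_e; rewrite linear0; apply: (is_product_separated prodP) => i.
  exact: (x0 (p i \o e)).
pose ev := fun k : {linear X -> T} => k.
exists {linear X -> T}, (dprod (fun=> T)), (@dprod_proj _ _ _).
split; first exact: dprod_is_product.
by exists (dprod_pair ev); apply: dprod_pair_inj.
Qed.

Lemma Cogen_products (R : pzRingType) (T : rmod R) :
  closed_under_products (Cogen T).
Proof.
move=> I X P p prodP CX; apply/Cogen_separated => x x0.
apply: (is_product_separated prodP) => i.
by apply: (Cogen_separated T (X i)).1 => // k; apply: (x0 (k \o p i)).
Qed.

Lemma partial_cosilting_of_cosilting (R : pzRingType) (T : rmod R) :
  cosilting T -> partial_cosilting T.
Proof.
move=> [Q0 [Q1 [iota [zeta [injQ0 injQ1 exact_iota CB]]]]].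
exists Q0, Q1, iota, zeta; split=> //.
  apply/CB/Cogen_separated => t t0; exact: (t0 idfun).
move=> I X P p prodP BX; apply/CB; apply: (Cogen_products prodP) => i.
exact/CB.
Qed.

Theorem theorem4p7 (R : pzRingType) :
  (forall T : rmod R, partial_cosilting T -> pure_injective T) /\
  (forall T : rmod R, cosilting T -> pure_injective T).
Proof.
split=> T; first exact: pure_injective_of_partial_cosilting.
by move/partial_cosilting_of_cosilting/pure_injective_of_partial_cosilting.
Qed.
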